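(* Let $N\ge 2$ be an integer, let $k$ be a field, and let $M$ be an $N$-complex of finite dimensional $k$-vector spaces (that is, each ${}_iM$ is finite dimensional). Then there exists an amplitude $a\in[1,N-1]$ with $(AH)_a^*(M)=0$ (i.e. $(AH)_a^i(M)=0$ for all $i\in\mathbb{Z}$) if and only if $M$ is projective (or equivalently injective) in the category of $N$-complexes. Moreover, in this case $(AH)_a^*(M)=0$ for any amplitude $a\in[1,N-1]$.
   Context: An $N$-complex is a $\mathbb{Z}$-graded $k$-vector space $\{{}_iM\}_{i\in\mathbb{Z}}$ together with linear maps $d_i:{}_iM\to{}_{i+1}M$ such that $d_{i+N-1}\circ\dots\circ d_i=0$ for each $i\in\mathbb{Z}$. Morphisms are degree-preserving linear maps commuting with the $d_i$; with these, $N$-complexes form an abelian category, and projective and injective refer to this category. For an integer $a$ with $1\le a\le N-1$ (an amplitude) and $i\in\mathbb{Z}$, the amplitude cohomology of $M$ is $$(AH)_a^i(M):=\ker(d_{i+a-1}\circ\dots\circ d_i)/\mathrm{im}(d_{i-1}\circ\dots\circ d_{i-N+a}),$$ that is, $\ker(d^a)/\mathrm{im}(d^{N-a})$ at degree $i$. $(AH)_a^*(M)$ denotes the graded vector space with components $(AH)_a^i(M)$. *)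

(* Defs.v *)
From HB Require Import structures.
From mathcomp Require Import all_boot all_order all_algebra.
From mathcomp Require Import generic_quotient ring_quotient boolp.

Set Implicit Arguments.
Unset Strict Implicit.
Unset Printing Implicit Defensive.

Import GRing.Theory.
Local Open Scope ring_scope.


Section LinearKernel.
Variables (k : fieldType) (V W : lmodType k) (g : {linear V -> W}).

Definition lin_kerb : pred V := fun x => g x == 0.

Lemma lin_kerb_submod : submod_closed lin_kerb.
Proof.
split=> [|c u v]; rewrite !unfold_in ?linear0 //.
by rewrite linearP => /eqP-> /eqP->; rewrite scaler0 addr0.
Qed.

HB.instance Definition _ :=
  GRing.isSubmodClosed.Build k V lin_kerb lin_kerb_submod.

Record lin_ker := LinKer { lin_ker_val : V; _ : lin_kerb lin_ker_val }.

HB.instance Definition _ := [isSub for lin_ker_val].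
HB.instance Definition _ := [Choice of lin_ker by <:].
HB.instance Definition _ := [SubChoice_isSubLmodule of lin_ker by <:].

End LinearKernel.

Section Subquotient.
Variables (k : fieldType) (U V W : lmodType k).
Variables (f : {linear U -> V}) (g : {linear V -> W}).

(* The part of im f that lies in ker g; it is im f itself when g \o f = 0,
   the only case of interest. *)
Definition lin_imb : pred (lin_ker g) := fun z => `[< exists y, f y = val z >].

Lemma lin_imb_submod : submod_closed lin_imb.
Proof.
split=> [|c u v]; rewrite !unfold_in.
  by apply/asboolP; exists 0; rewrite !linear0.
move=> /asboolP[y yu] /asboolP[z zv]; apply/asboolP; exists (c *: y + z).
by rewrite !linearP yu zv.
Qed.

HB.instance Definition _ :=
  GRing.isSubmodClosed.Build k (lin_ker g) lin_imb lin_imb_submod.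

Definition lin_im : zmodClosed (lin_ker g) :=
  GRing.ZmodClosed.clone (lin_ker g) lin_imb _.

Definition ker_mod_im : Type := Quotient.quot lin_im.
HB.instance Definition _ := GRing.Zmodule.on ker_mod_im.

Local Open Scope quotient_scope.

Definition ker_mod_im_pi (z : lin_ker g) : ker_mod_im :=
  \pi_(Quotient.quot lin_im) z.

Definition ker_mod_im_scale (c : k) (x : ker_mod_im) : ker_mod_im :=
  ker_mod_im_pi (c *: repr (x : Quotient.quot lin_im)).

Lemma ker_mod_im_pi_surj x : exists z, x = ker_mod_im_pi z.
Proof. by exists (repr (x : Quotient.quot lin_im)); rewrite /ker_mod_im_pi reprK. Qed.

Lemma ker_mod_im_pi_eq z t :
  ker_mod_im_pi z = ker_mod_im_pi t <-> exists y, f y = val (z - t).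
Proof.
rewrite /ker_mod_im_pi; split=> [/eqP|zt].
  by rewrite -Quotient.idealrBE => /asboolP.
by apply/eqP; rewrite -Quotient.idealrBE; apply/asboolP.
Qed.

Lemma ker_mod_im_piD z t :
  ker_mod_im_pi (z + t) = ker_mod_im_pi z + ker_mod_im_pi t.
Proof. exact: (raddfD (\pi_(Quotient.quot lin_im))). Qed.

Lemma ker_mod_im_piZ c z :
  ker_mod_im_scale c (ker_mod_im_pi z) = ker_mod_im_pi (c *: z).
Proof.
apply/ker_mod_im_pi_eq; set t := repr _.
have [y yP] : exists y, f y = val (t - z).
  by apply/ker_mod_im_pi_eq; rewrite /ker_mod_im_pi reprK.
by exists (c *: y); rewrite -scalerBr !linearZ /= yP.
Qed.

Lemma ker_mod_im_scaleA a b x :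
  ker_mod_im_scale a (ker_mod_im_scale b x) = ker_mod_im_scale (a * b) x.
Proof.
by have [z ->] := ker_mod_im_pi_surj x; rewrite !ker_mod_im_piZ scalerA.
Qed.

Lemma ker_mod_im_scale1 : left_id 1 ker_mod_im_scale.
Proof.
by move=> x; have [z ->] := ker_mod_im_pi_surj x; rewrite ker_mod_im_piZ scale1r.
Qed.

Lemma ker_mod_im_scaleDr : right_distributive ker_mod_im_scale +%R.
Proof.
move=> c x y; have [z ->] := ker_mod_im_pi_surj x.
have [t ->] := ker_mod_im_pi_surj y.
by rewrite -ker_mod_im_piD !ker_mod_im_piZ scalerDr ker_mod_im_piD.
Qed.

Lemma ker_mod_im_scaleDl x : {morph ker_mod_im_scale^~ x : a b / a + b}.
Proof.
move=> a b; have [z ->] := ker_mod_im_pi_surj x.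
by rewrite !ker_mod_im_piZ scalerDl ker_mod_im_piD.
Qed.

HB.instance Definition _ := GRing.Zmodule_isLmodule.Build k ker_mod_im
  ker_mod_im_scaleA ker_mod_im_scale1 ker_mod_im_scaleDr ker_mod_im_scaleDl.

End Subquotient.


(* [degshift n i] is i + n, in the form i + 1 + ... + 1 that makes the iterated
   composite of the differentials typecheck without transport. *)
Fixpoint degshift (n : nat) (i : int) : int :=
  if n is m.+1 then degshift m (i + 1) else i.

Lemma degshiftE n i : degshift n i = i + n%:Z.
Proof.
by elim: n i => [|n IHn] i /=; rewrite ?addr0 // IHn intS addrA.
Qed.

Lemma degshiftK n i : degshift n (i - n%:Z) = i.
Proof. by rewrite degshiftE subrK. Qed.

Section Composites.
Variables (k : fieldType) (V : int -> lmodType k).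

Definition degcast (i j : int) (e : i = j) : V i -> V j :=
  fun x => eq_rect i (fun l => V l) x j e.

Lemma degcast_is_linear i j (e : i = j) : linear (degcast e).
Proof. by case: _ / e. Qed.

HB.instance Definition _ i j (e : i = j) :=
  GRing.isLinear.Build k (V i) (V j) *:%R (degcast e) (degcast_is_linear e).

Variable d : forall i, {linear V i -> V (i + 1)}.

(* d_{i+n-1} o ... o d_i *)
Fixpoint dpow (n : nat) : forall i, {linear V i -> V (degshift n i)} :=
  if n is m.+1 then fun i => dpow m (i + 1) \o d i else fun i => idfun.

(* d_{i-1} o ... o d_{i-n} *)
Definition dpow_into (n : nat) (i : int) : {linear V (i - n%:Z) -> V i} :=
  degcast (degshiftK n i) \o dpow n (i - n%:Z).

End Composites.

Record ncomplex (k : fieldType) (N : nat) := NComplex {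
  nc_obj :> int -> lmodType k;
  nc_d : forall i, {linear nc_obj i -> nc_obj (i + 1)};
  nc_dN : forall i x, dpow nc_d N i x = 0
}.

Record nc_hom (k : fieldType) (N : nat) (A B : ncomplex k N) := NCHom {
  nc_fun :> forall i, {linear A i -> B i};
  nc_comm : forall i x, nc_fun (i + 1) (nc_d A i x) = nc_d B i (nc_fun i x)
}.

Section Category.
Variables (k : fieldType) (N : nat).
Implicit Types A B C D M : ncomplex k N.

Definition nc_eq A B (f g : nc_hom A B) : Prop := forall i, f i =1 g i.

Definition nc_id A : nc_hom A A :=
  @NCHom k N A A (fun i => idfun) (fun i x => erefl).

Lemma nc_comp_comm A B C (g : nc_hom B C) (f : nc_hom A B) i x :
  g (i + 1) (f (i + 1) (nc_d A i x)) = nc_d C i (g i (f i x)).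
Proof. by rewrite !nc_comm. Qed.

Definition nc_comp A B C (g : nc_hom B C) (f : nc_hom A B) : nc_hom A C :=
  @NCHom k N A C (fun i => g i \o f i) (nc_comp_comm g f).

Definition nc_mono A B (f : nc_hom A B) : Prop :=
  forall C (g h : nc_hom C A), nc_eq (nc_comp f g) (nc_comp f h) -> nc_eq g h.

Definition nc_epi A B (f : nc_hom A B) : Prop :=
  forall C (g h : nc_hom B C), nc_eq (nc_comp g f) (nc_comp h f) -> nc_eq g h.

(* A and B range over all N-complexes, with no finiteness condition. *)
Definition nc_projective M : Prop :=
  forall A B (p : nc_hom A B), nc_epi p ->
  forall f : nc_hom M B, exists g : nc_hom M A, nc_eq (nc_comp p g) f.

Definition nc_injective M : Prop :=
  forall A B (m : nc_hom A B), nc_mono m ->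
  forall f : nc_hom A M, exists g : nc_hom B M, nc_eq (nc_comp g m) f.

End Category.

(* Same condition as [Vector.axiom], for spaces with no vectType structure. *)
Definition finite_dim (k : fieldType) (V : lmodType k) : Prop :=
  exists (n : nat) (f : {linear V -> 'rV[k]_n}), bijective f.

Definition AH (k : fieldType) (N : nat) (M : ncomplex k N) (a : nat) (i : int) :
    lmodType k :=
  ker_mod_im (dpow_into (nc_d M) (N - a) i) (dpow (nc_d M) a i).

Lemma dpow_cast (k : fieldType) (V : int -> lmodType k)
    (d : forall i, {linear V i -> V (i + 1)}) n i j (e : i = j) (x : V i) :
  dpow d n i x = 0 -> dpow d n j (degcast e x) = 0.
Proof. by case: _ / e. Qed.

Lemma dpow_add (k : fieldType) (V : int -> lmodType k)
    (d : forall i, {linear V i -> V (i + 1)}) m n i (x : V i) :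
  dpow d (m + n) i x = 0 -> dpow d n (degshift m i) (dpow d m i x) = 0.
Proof. by elim: m i x => [|m IHm] i x //= /IHm. Qed.

(* For amplitudes a <= N the image of d^(N-a) lies in the kernel of d^a, so that
   [AH M a i] is the full quotient ker (d^a) / im (d^(N-a)). *)
Lemma AH_im_sub_ker (k : fieldType) (N : nat) (M : ncomplex k N) (a : nat)
    (i : int) (y : M (i - (N - a)%N%:Z)) :
  (a <= N)%N -> dpow (nc_d M) a i (dpow_into (nc_d M) (N - a) i y) = 0.
Proof.
move=> aN; apply: dpow_cast; apply: dpow_add.
by rewrite subnK //; apply: nc_dN.
Qed.

Definition AH_vanishes (k : fieldType) (N : nat) (M : ncomplex k N) (a : nat) :
    Prop :=
  forall (i : int) (x : AH M a i), x = 0.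

(* Main.v *)
(* Write n = N - 1.  For a family V of vector spaces let [freeC V] be the N-complex whose
   degree i part is the product of the V t, with a differential that keeps the
   t-component as long as t <= i < t + n.  Families of linear maps V t -> B t, resp.
   A (t + n) -> V t, induce morphisms freeC V -> B, resp. A -> freeC V.  A family
   s t : M (t + n) -> M t thus induces an endomorphism sum_j d^j s d^(n-j) of M through
   freeC M, and M is contractible when some s induces the identity; lifting or extending
   linear maps degreewise then shows that M is projective and injective.
   - If ker d^a = im d^(N-a) for one a, then ker d = im d^n, and degreewise sections of
     d^n over ker d give an s whose endomorphism h is the identity on ker d.  Then 1 - h
     maps ker d^(m+1) into ker d^m, and correcting s repeatedly makes h the identity.
   - Conversely, M is a quotient of freeC M and a subobject of freeC (t |-> M (t + n)).
     If M is projective or injective this quotient or inclusion splits, and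
     ker d^a = im d^(N-a) is read off componentwise.
   The spaces of a test object may be infinite dimensional, so linear maps are extended
   from subspaces by Zorn's lemma. *)
From HB Require Import structures.
Require Import Defs.
From mathcomp Require Import all_boot all_order all_algebra.
From mathcomp Require Import boolp classical_sets.
From mathcomp Require Import zify.

Set Implicit Arguments.
Unset Strict Implicit.
Unset Printing Implicit Defensive.

Import Order.TTheory GRing.Theory Num.Theory.
Local Open Scope ring_scope.

Lemma dep_choice (I : Type) (T : I -> Type) (P : forall i, T i -> Prop) :
  (forall i, exists x, P i x) -> exists f : forall i, T i, forall i, P i (f i).
Proof. by move=> exP; exists (fun i => sval (cid (exP i))) => i; case: cid. Qed.

(** * Linear selections, projectors, lifts and extensions in arbitrary dimension *)

Section LinearExtension.
Variable k : fieldType.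
Implicit Types V W : lmodType k.

Definition linear_of V W (f : V -> W) (fL : linear f) : {linear V -> W} :=
  HB.pack f (GRing.isLinear.Build k V W *:%R f fL).

Definition linear_rel V W (R : V -> W -> Prop) : Prop :=
  R 0 0 /\
  forall c u v u' v', R u v -> R u' v' -> R (c *: u + u') (c *: v + v').

Lemma linear_relZ V W (R : V -> W -> Prop) c u v :
  linear_rel R -> R u v -> R (c *: u) (c *: v).
Proof. by move=> [R0 RL] Ruv; rewrite -[c *: u]addr0 -[c *: v]addr0; apply: RL. Qed.

Lemma linear_relB V W (R : V -> W -> Prop) u v u' v' :
  linear_rel R -> R u v -> R u' v' -> R (u - u') (v - v').
Proof.
move=> [_ RL] Ruv Ruv'; rewrite -scaleN1r -[- v']scaleN1r addrC [v + _]addrC.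
exact: RL.
Qed.

(* Zorn's lemma applied to the linear single-valued relations between G and R. *)
Lemma linear_selection V W (R G : V -> W -> Prop) :
    linear_rel R -> (forall u, exists v, R u v) ->
    linear_rel G -> (forall u v, G u v -> R u v) -> (forall v, G 0 v -> v = 0) ->
  exists f : {linear V -> W},
    (forall u, R u (f u)) /\ (forall u v, G u v -> f u = v).
Proof.
move=> lR Rtot lG GR Gfun.
(* Adjoining [G] here, instead of asking that [S] contain it, lets the union of the empty chain
   satisfy [P]. *)
pose U (S : set (V * W)) u v := S (u, v) \/ G u v.
pose P S := [/\ linear_rel (U S), (forall u v, U S u v -> R u v) &
                (forall v, U S 0 v -> v = 0)].
have [|S [[lS SR Sfun] Smax]] := @Zorn_bigcup _ P.
  move=> F FP Ftot.
  have FU u v : U (\bigcup_(X in F) X)%classic u v <->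
      G u v \/ exists2 X, F X & U X u v.
    split=> [[[X FX Xuv]|Guv]|[Guv|[X FX [Xuv|Guv]]]]; [right|left|right|left|right] => //.
    - by exists X => //; left.
    - by exists X.
  have Gin X u v : G u v -> U X u v by right.
  have Usub (X Y : set (V * W)) u v : (X `<=` Y)%classic -> U X u v -> U Y u v.
    by move=> XY [/XY|]; [left|right].
  split.
  - split=> [|c u v u' v']; first by apply/FU; left; case: lG.
    move=> /FU[Guv|[X FX Xuv]] /FU[Guv'|[Y FY Yuv]]; apply/FU.
    + by left; case: lG => _; apply.
    + right; exists Y => //; have [[_ YL] _ _] := FP _ FY.
      by apply: YL => //; apply: Gin.
    + right; exists X => //; have [[_ XL] _ _] := FP _ FX.
      by apply: XL => //; apply: Gin.
    + right; have [XY|YX] := Ftot _ _ FX FY.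
      * exists Y => //; have [[_ YL] _ _] := FP _ FY.
        by apply: YL => //; apply: Usub Xuv.
      * exists X => //; have [[_ XL] _ _] := FP _ FX.
        by apply: XL => //; apply: Usub Yuv.
  - by move=> u v /FU[/GR//|[X /FP[_ XR _] /XR]].
  - by move=> v /FU[/Gfun//|[X /FP[_ _ Xf] /Xf]].
have Stot u : exists v, U S u v.
  apply: contrapT => nu; have [w Ruw] := Rtot u.
  (* If [u] is outside the domain of a maximal [S], adjoin the line through [(u, w)]. *)
  pose T : set (V * W) :=
    fun z => exists c u' v', U S u' v' /\ z = (c *: u + u', c *: w + v').
  have ST : (S `<=` T)%classic.
    by move=> [u' v'] Suv; exists 0, u', v'; rewrite !scale0r !add0r; split=> //; left.
  have GT u' v' : G u' v' -> T (u', v').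
    by move=> Guv; exists 0, u', v'; rewrite !scale0r !add0r; split=> //; right.
  have UT u' v' : U T u' v' -> T (u', v') by case=> // /GT.
  have SL c u1 v1 u2 v2 : U S u1 v1 -> U S u2 v2 -> U S (c *: u1 + u2) (c *: v1 + v2).
    by case: lS => _; apply.
  apply: (Smax T).
    split=> // TS; apply: nu; exists w; left; apply: TS.
    by exists 1, 0, 0; rewrite !scale1r !addr0; split=> //; case: lS.
  split.
  - split=> [|c u1 v1 u2 v2 /UT[a [u3 [v3 [S3 [-> ->]]]]]].
      by right; case: lG.
    move=> /UT[b [u4 [v4 [S4 [-> ->]]]]]; left.
    exists (c * a + b), (c *: u3 + u4), (c *: v3 + v4); split; first exact: SL.
    by congr pair; rewrite scalerDr scalerDl scalerA addrACA.
  - move=> u1 v1 /UT[a [u3 [v3 [/SR S3 [-> ->]]]]].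
    by case: lR => _; apply.
  - move=> v1 /UT[a [u3 [v3 [S3 [e ->]]]]].
    (* A nonzero [a] would make [u] a multiple of [u3], hence put it in the domain after all. *)
    have [a0|a0] := eqVneq a 0.
      move: e S3; rewrite a0 !scale0r !add0r => <-; exact: Sfun.
    case: nu; exists (- a^-1 *: v3).
    suff -> : u = - a^-1 *: u3 by apply: linear_relZ.
    by rewrite -(addr0_eq (esym e)) scaleNr scalerN opprK scalerA mulVf ?scale1r.
have [f Sf] := choice Stot.
have SfE u v : U S u v -> f u = v.
  move=> Suv; apply/eqP; rewrite -subr_eq0; apply/eqP/Sfun.
  by rewrite -(subrr u); apply: linear_relB.
have fL : linear f.
  by move=> c u v; apply: SfE; case: lS => _; apply.
exists (linear_of fL); split=> [u|u v Guv]; first exact: SR.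
by apply: SfE; right.
Qed.

Lemma linear_projector V (S : V -> Prop) :
    S 0 -> (forall c u v, S u -> S v -> S (c *: u + v)) ->
  exists f : {linear V -> V}, (forall u, S (f u)) /\ (forall u, S u -> f u = u).
Proof.
move=> S0 SL.
have [||||v []//|f [fS fid]] := @linear_selection V V (fun _ y => S y)
  (fun x y => S x /\ y = x).
- by split=> // c u v u' v'; apply: SL.
- by exists 0.
- by split=> // c u v u' v' [Su ->] [Su' ->]; split=> //; apply: SL.
- by move=> u v [Su ->].
by exists f; split=> // u Su; apply: fid.
Qed.

Lemma linear_lift V W (X : lmodType k) (p : {linear V -> W}) (f : {linear X -> W}) :
  (forall x, exists v, p v = f x) -> exists h : {linear X -> V}, forall x, p (h x) = f x.
Proof.
move=> psurj.
have [||||v []//|h [ph _]] := @linear_selection X V (fun x v => p v = f x)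
  (fun x v => x = 0 /\ v = 0).
- by split=> [|c u v u' v' e e']; rewrite ?linear0 // !linearP e e'.
- by move=> u; apply: psurj.
- by split=> // c u v u' v' [-> ->] [-> ->]; rewrite !scaler0 !addr0.
- by move=> u v [-> ->]; rewrite !linear0.
by exists h.
Qed.

Lemma linear_extend V W (X : lmodType k) (m : {linear V -> W}) (f : {linear V -> X}) :
  (forall v, m v = 0 -> v = 0) -> exists h : {linear W -> X}, forall v, h (m v) = f v.
Proof.
move=> minj.
have [|||//||h [_ hm]] := @linear_selection W X (fun _ _ => True)
  (fun w x => exists2 v, w = m v & x = f v).
- by [].
- by exists 0.
- split=> [|c u v u' v' [a -> ->] [b -> ->]]; first by exists 0; rewrite ?linear0.
  by exists (c *: a + b); rewrite !linearP.
- by move=> x [v /esym/minj-> ->]; rewrite linear0.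
by exists h => v; apply: hm; exists v.
Qed.

End LinearExtension.

(** * Composites of differentials indexed by source and target degree *)

Section DegreePaths.
Variables (k : fieldType) (V : int -> lmodType k).
Variable d : forall i, {linear V i -> V (i + 1)}.

(* d_{i-1} o ... o d_t, and 0 when i < t. *)
Definition dpath (i t : int) : {linear V t -> V i} :=
  match degshift `|i - t| t =P i with
  | ReflectT e => degcast e \o dpow d `|i - t| t
  | ReflectF _ => \0
  end.

(** Any proof [e] will do, since equality proofs in [int] are unique. *)
Lemma dpathE n t i (e : degshift n t = i) x : dpath i t x = degcast e (dpow d n t x).
Proof.
case: _ / e; rewrite /dpath; have -> : `|(degshift n t - t)%R|%N = n.
  by rewrite degshiftE addrAC subrr add0r absz_nat.
by case: eqP => // e; rewrite (eq_irrelevance e erefl).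
Qed.

Lemma dpath_id i x : dpath i i x = x.
Proof. exact: (@dpathE 0 i i erefl x). Qed.

Lemma dpath1 i x : dpath (i + 1) i x = d i x.
Proof. exact: (@dpathE 1 i (i + 1) erefl x). Qed.

Lemma dpath_lt (i t : int) x : i < t -> dpath i t x = 0.
Proof.
rewrite /dpath => it; case: eqP => // e; exfalso; move: e; rewrite degshiftE; lia.
Qed.

Lemma dpath_dr (i t : int) x : t < i -> dpath i (t + 1) (d t x) = dpath i t x.
Proof.
move=> ti; have e : degshift `|(i - (t + 1))%R|%N (t + 1) = i by rewrite degshiftE; lia.
by rewrite (dpathE e) (@dpathE `|(i - (t + 1))%R|%N.+1 t i e).
Qed.

Lemma dpath_comp (i j t : int) x : t <= j -> j <= i -> dpath i j (dpath j t x) = dpath i t x.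
Proof.
move=> tj ji; have [n e] : exists n : nat, j = t + n%:Z by exists `|(j - t)%R|%N; lia.
elim: n t tj x e => [|n IHn] t tj x e.
  by have -> : j = t; [lia | rewrite dpath_id].
have ltj : t < j by lia.
by rewrite -(dpath_dr _ ltj) IHn ?dpath_dr //; lia.
Qed.

Lemma dpath_dl (i t : int) x : t <= i -> dpath (i + 1) t x = d i (dpath i t x).
Proof. by move=> ti; rewrite -dpath1 dpath_comp //; lia. Qed.

End DegreePaths.

(** * Composites of differentials in an N-complex, and amplitude cohomology through them *)

Section NComplexPaths.
Variables (k : fieldType).

Lemma dpath_eq0 N (A : ncomplex k N) (i t : int) x : t + N%:Z <= i -> dpath (nc_d A) i t x = 0.
Proof.
move=> ti; rewrite -(@dpath_comp _ _ _ _ (t + N%:Z)) //; last by lia.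
rewrite (@dpathE _ _ _ N t _ (degshiftE N t)) nc_dN !linear0 //.
Qed.

Lemma dpath_comm N (A B : ncomplex k N) (f : nc_hom A B) (i t : int) x :
  f i (dpath (nc_d A) i t x) = dpath (nc_d B) i t (f t x).
Proof.
have [ti|it] := leP t i; last by rewrite !dpath_lt ?linear0.
have [n e] : exists n : nat, i = t + n%:Z by exists `|(i - t)%R|%N; lia.
elim: n t ti x e => [|n IHn] t ti x e.
  by have -> : i = t; [lia | rewrite !dpath_id].
have lti : t < i by lia.
by rewrite -!(dpath_dr _ _ lti) IHn ?nc_comm //; lia.
Qed.

(** Removes quotients and casts from vanishing; later arguments use this elementwise form. *)
Lemma AH_vanishesP N (M : ncomplex k N) a : (a <= N)%N ->
  AH_vanishes M a <->
  forall i x, dpath (nc_d M) (i + a%:Z) i x = 0 ->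
    exists y, x = dpath (nc_d M) i (i - (N - a)%N%:Z) y.
Proof.
move=> aN; split=> [H i x x0|H i z].
  have kx : lin_kerb (dpow (nc_d M) a i) x.
    apply/eqP; move: x0; rewrite (dpathE _ (degshiftE a i)).
    by case: _ / (degshiftE a i).
  have /ker_mod_im_pi_eq[y yx] : ker_mod_im_pi (dpow_into (nc_d M) (N - a) i)
      (LinKer kx) = ker_mod_im_pi _ 0 by rewrite [LHS]H [RHS]H.
  exists y; rewrite (dpathE _ (degshiftK (N - a) i)).
  by rewrite subr0 in yx.
have [[x kx] ->] := ker_mod_im_pi_surj z.
have [|y xy] := H i x.
  by rewrite (dpathE _ (degshiftE a i)); move/eqP: kx => ->; rewrite linear0.
suff -> : ker_mod_im_pi (dpow_into (nc_d M) (N - a) i) (LinKer kx) =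
  ker_mod_im_pi _ 0.
  exact: raddf0.
apply/ker_mod_im_pi_eq; exists y; rewrite subr0 /= xy.
by rewrite (dpathE _ (degshiftK (N - a) i)).
Qed.

End NComplexPaths.

(** * The product of a family of vector spaces *)

Section DependentProduct.
Variables (k : fieldType) (V : int -> lmodType k).

Definition dprod := forall t, V t.
HB.instance Definition _ := Choice.on dprod.

Let dadd (m m' : dprod) : dprod := fun t => m t + m' t.
Let dscale (c : k) (m : dprod) : dprod := fun t => c *: m t.

Fact dprod_addA : associative dadd.
Proof. by move=> m m' m''; apply: functional_extensionality_dep => t; apply: addrA. Qed.
Fact dprod_addC : commutative dadd.
Proof. by move=> m m'; apply: functional_extensionality_dep => t; apply: addrC. Qed.
Fact dprod_add0 : left_id (fun t => 0 : V t) dadd.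
Proof. by move=> m; apply: functional_extensionality_dep => t; apply: add0r. Qed.
Fact dprod_addN : left_inverse (fun t => 0 : V t) (fun m t => - m t) dadd.
Proof. by move=> m; apply: functional_extensionality_dep => t; apply: addNr. Qed.

HB.instance Definition _ :=
  GRing.isZmodule.Build dprod dprod_addA dprod_addC dprod_add0 dprod_addN.

Fact dprod_scaleA a b m : dscale a (dscale b m) = dscale (a * b) m.
Proof. by apply: functional_extensionality_dep => t; apply: scalerA. Qed.
Fact dprod_scale1 : left_id 1 dscale.
Proof. by move=> m; apply: functional_extensionality_dep => t; apply: scale1r. Qed.
Fact dprod_scaleDr : right_distributive dscale +%R.
Proof. by move=> c m m'; apply: functional_extensionality_dep => t; apply: scalerDr. Qed.
Fact dprod_scaleDl m : {morph dscale^~ m : a b / a + b}.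
Proof. by move=> a b; apply: functional_extensionality_dep => t; apply: scalerDl. Qed.

HB.instance Definition _ := GRing.Zmodule_isLmodule.Build k dprod
  dprod_scaleA dprod_scale1 dprod_scaleDr dprod_scaleDl.

Lemma dprod_linE c (m m' : dprod) t : (c *: m + m') t = c *: m t + m' t.
Proof. by []. Qed.

End DependentProduct.

(** * The complexes [freeC V], their induced morphisms, and monos and epis *)

Section FreeComplex.
Variables (k : fieldType) (n : nat).
Implicit Types (A B : ncomplex k n.+1) (V : int -> lmodType k) (i t : int).

(* The components outside t <= i <= t + n are junk: [free_diff] sends them to 0 and
   never reaches them. *)
Definition free_diff V i (m : dprod V) : dprod V :=
  fun t => if (t <= i) && (i < t + n%:Z) then m t else 0.

Fact free_diff_linear V i : linear (@free_diff V i).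
Proof.
move=> c u v; apply: functional_extensionality_dep => t.
rewrite dprod_linE /free_diff; case: ifP => _; first exact: dprod_linE.
by rewrite scaler0 addr0.
Qed.

HB.instance Definition _ V i :=
  GRing.isLinear.Build k (dprod V) (dprod V) *:%R (@free_diff V i)
    (@free_diff_linear V i).

(** The exponent starts at 1 because the zeroth power, the identity, keeps the junk. *)
Lemma dpow_free V j i (m : dprod V) t :
  (dpow (fun i' => @free_diff V i' : {linear _ -> _}) j.+1 i m : dprod V) t =
  if (t <= i) && (i + j%:Z < t + n%:Z) then m t else 0.
Proof.
elim: j i m => [|j IHj] i m; first by congr (if _ then _ else _); lia.
change (dpow (fun i' => @free_diff V i' : {linear _ -> _}) j.+2 i m) with
  (dpow (fun i' => @free_diff V i' : {linear _ -> _}) j.+1 (i + 1) (free_diff i m)).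
rewrite IHj /free_diff; by do !case: ifP => //; lia.
Qed.

Fact free_diffN V i (m : dprod V) :
  dpow (fun i' => @free_diff V i' : {linear _ -> _}) n.+1 i m = 0.
Proof.
apply: functional_extensionality_dep => t.
by rewrite dpow_free; case: ifP => //; lia.
Qed.

(** Having the same space in every degree avoids transport along degree equations. *)
Definition freeC V : ncomplex k n.+1 :=
  @NComplex k n.+1 (fun=> dprod V) (fun i => @free_diff V i) (@free_diffN V).

Lemma dpath_free V i i' (m : freeC V i) t : i < i' ->
  (dpath (nc_d (freeC V)) i' i m : dprod V) t =
  if (t <= i) && (i' <= t + n%:Z) then m t else 0.
Proof.
move=> ii'; have [j e] : exists j : nat, degshift j.+1 i = i'.
  by exists `|(i' - i - 1)%R|%N; rewrite degshiftE; lia.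
rewrite (dpathE _ e).
have -> : degcast (V := freeC V) e (dpow (nc_d (freeC V)) j.+1 i m) =
  dpow (nc_d (freeC V)) j.+1 i m :> dprod V by case: _ / e.
rewrite dpow_free; move: e; rewrite degshiftE => e.
by congr (if _ then _ else _); lia.
Qed.

Section FreeMap.
Variables (V : int -> lmodType k) (B : ncomplex k n.+1).
Variable phi : forall t, {linear V t -> B t}.

(** Only the components t with i - n <= t <= i are read, so junk is ignored. *)
Definition free_fun i (m : freeC V i) : B i :=
  \sum_(j < n.+1) dpath (nc_d B) i (i - j%:Z) (phi (i - j%:Z) (m (i - j%:Z))).

Fact free_fun_linear i : linear (@free_fun i).
Proof.
move=> c u v; rewrite /free_fun scaler_sumr -big_split; apply: eq_bigr => j _.
by rewrite dprod_linE !linearP.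
Qed.

HB.instance Definition _ i :=
  GRing.isLinear.Build k (freeC V i) (B i) *:%R (@free_fun i) (@free_fun_linear i).

Fact free_fun_comm i (m : freeC V i) :
  free_fun (nc_d (freeC V) i m) = nc_d B i (free_fun m).
Proof.
(* The first term on the left vanishes, as component i + 1 is not reached by [free_diff], and the
   last on the right vanishes by d^(n+1) = 0. The others match after a shift of j. *)
rewrite /free_fun big_ord_recl big_ord_recr linearD linear_sum /=.
rewrite -dpath_dl; last by lia.
rewrite [X in _ = _ + X](dpath_eq0 (A := B)); last by lia.
rewrite [RHS]addr0 {1}/free_diff ifF ?linear0 ?add0r; last by lia.
apply: eq_bigr => j _; rewrite -dpath_dl; last by lia.
have -> : i + 1 - (bump 0 j)%:Z = i - j%:Z by rewrite /bump; lia.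
by rewrite /free_diff ifT //; have := ltn_ord j; lia.
Qed.

Definition free_map : nc_hom (freeC V) B :=
  @NCHom k n.+1 (freeC V) B (fun i => @free_fun i) free_fun_comm.

End FreeMap.

Section CofreeMap.
Variables (V : int -> lmodType k) (A : ncomplex k n.+1).
Variable psi : forall t, {linear A (t + n%:Z) -> V t}.

Definition cofree_fun i (x : A i) : freeC V i :=
  fun t => psi t (dpath (nc_d A) (t + n%:Z) i x).

Fact cofree_fun_linear i : linear (@cofree_fun i).
Proof.
move=> c u v; apply: functional_extensionality_dep => t.
by rewrite dprod_linE /cofree_fun !linearP.
Qed.

HB.instance Definition _ i :=
  GRing.isLinear.Build k (A i) (freeC V i) *:%R (@cofree_fun i)
    (@cofree_fun_linear i).

Fact cofree_fun_comm i (x : A i) :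
  cofree_fun (nc_d A i x) = nc_d (freeC V) i (cofree_fun x).
Proof.
apply: functional_extensionality_dep => t; rewrite /= /free_diff /cofree_fun.
have [lt1|lt1] := ltP i (t + n%:Z); last first.
  by rewrite andbF dpath_lt ?linear0 //; lia.
rewrite andbT dpath_dr //; case: leP => // lt2.
by rewrite (dpath_eq0 (A := A)) ?linear0 //; lia.
Qed.

Definition cofree_map : nc_hom A (freeC V) :=
  @NCHom k n.+1 A (freeC V) (fun i => @cofree_fun i) cofree_fun_comm.

End CofreeMap.

Lemma free_mapE V B (phi : forall t, {linear V t -> B t}) i (m : freeC V i) :
  free_map phi i m =
  \sum_(j < n.+1) dpath (nc_d B) i (i - j%:Z) (phi (i - j%:Z) (m (i - j%:Z))).
Proof. by []. Qed.

Lemma cofree_mapE V A (psi : forall t, {linear A (t + n%:Z) -> V t}) i (x : A i) t :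
  (cofree_map psi i x : dprod V) t = psi t (dpath (nc_d A) (t + n%:Z) i x).
Proof. by []. Qed.

(** A family supported at component [i] leaves only the term j = 0. *)
Lemma free_map_top V B (phi : forall t, {linear V t -> B t}) i (v : V i) :
  exists m, free_map phi i m = phi i v.
Proof.
pose m : dprod V := fun t => if i =P t is ReflectT e then degcast e v else 0.
have mi t : t = i -> dpath (nc_d B) i t (phi t (m t)) = phi i v.
  move=> ->; rewrite dpath_id /m; case: eqP => // e.
  by rewrite (eq_irrelevance e erefl).
have m0 t : t <> i -> m t = 0 by rewrite /m; case: eqP => // e; case: _ / e.
exists m; rewrite free_mapE big_ord_recl big1 => [|j _]; last first.
  by rewrite m0 ?linear0 //= /bump; lia.
by rewrite addr0 mi //=; lia.
Qed.

Lemma cofree_map_bottom V A (psi : forall t, {linear A (t + n%:Z) -> V t}) t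
    (x : A (t + n%:Z)) :
  (cofree_map psi (t + n%:Z) x : dprod V) t = psi t x.
Proof. by rewrite cofree_mapE dpath_id. Qed.

(* Projecting each A t onto ker (f t) induces a morphism freeC A -> A that f kills. *)
Lemma nc_mono_inj A B (f : nc_hom A B) i x : nc_mono f -> f i x = 0 -> x = 0.
Proof.
move=> fmono fx0.
have kerP t : exists p : {linear A t -> A t},
    (forall u, f t (p u) = 0) /\ (forall u, f t u = 0 -> p u = u).
  apply: linear_projector => [|c u v fu fv]; first exact: linear0.
  by rewrite linearP fu fv scaler0 addr0.
have [p pP] := dep_choice kerP.
have [m pm] := free_map_top (B := A) p x.
rewrite -((pP i).2 x fx0) -pm.
rewrite (fmono _ (free_map p) (free_map (fun=> \0))) ?free_mapE.
  by rewrite big1 // => j _; rewrite linear0.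
move=> j m'; rewrite /= /free_fun !linear_sum; apply: eq_bigr => l _ /=.
by rewrite !dpath_comm (pP _).1 !linear0.
Qed.

(* Dually, a projector onto im f gives a morphism on B that kills the image of f. *)
Lemma nc_epi_surj A B (f : nc_hom A B) i : nc_epi f -> forall y, exists x, f i x = y.
Proof.
move=> fepi; have [t -> {i}] : exists t, i = t + n%:Z by exists (i - n%:Z); lia.
move=> y; have imP s : exists p : {linear B s -> B s},
    (forall u, exists x, f s x = p u) /\ (forall u, (exists x, f s x = u) -> p u = u).
  apply: linear_projector => [|c _ _ [u <-] [v <-]].
    by exists 0; rewrite linear0.
  by exists (c *: u + v); rewrite linearP.
have [p pP] := dep_choice imP.
pose psi s : {linear B (s + n%:Z) -> B (s + n%:Z)} := idfun \- p (s + n%:Z).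
have psi0 : nc_eq (cofree_map psi) (cofree_map (V := fun s => B (s + n%:Z)) (fun=> \0)).
  apply: fepi => j u; apply: functional_extensionality_dep => s /=.
  rewrite /cofree_fun -dpath_comm /= (pP _).2 ?subrr //.
  by exists (dpath (nc_d A) (s + n%:Z) j u).
have [x fx] := (pP _).1 y; exists x; rewrite fx.
apply/esym/eqP; rewrite -subr_eq0 -[_ - _]/(psi t y).
by rewrite -cofree_map_bottom psi0 cofree_map_bottom.
Qed.

End FreeComplex.

(** * Contractible complexes: projectivity, injectivity, and a criterion by exactness *)

Section Contraction.
Variables (k : fieldType) (n : nat) (M : ncomplex k n.+1).

Local Notation dM := (dpath (nc_d M)).
Local Notation homotopy := (forall t, {linear M (t + n%:Z) -> M t}).

(** The null-homotopic endomorphism given by [s]; factoring it through [freeC M] makes it a morphism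
    by construction. *)
Definition boundary (s : homotopy) : nc_hom M M :=
  nc_comp (free_map (V := M) (fun=> idfun)) (cofree_map s).

Lemma boundaryE (s : homotopy) i x :
  boundary s i x =
  \sum_(j < n.+1) dM i (i - j%:Z) (s (i - j%:Z) (dM (i - j%:Z + n%:Z) i x)).
Proof. by []. Qed.

Definition contractible : Prop :=
  exists s : homotopy, forall i x, boundary s i x = x.

(** With [h] a degreewise linear lift of [f], [p] turns the sum of the d^j h s d^(n-j) into [f]
    composed with [boundary s], which is [f]. *)
Lemma contractible_projective : contractible -> nc_projective M.
Proof.
move=> [s sM] A B p /nc_epi_surj psurj f.
have [h ph] := dep_choice (fun t => linear_lift (fun x => psurj t (f t x))).
exists (nc_comp (free_map h) (cofree_map s)) => i x.
rewrite -[in RHS](sM i x) /= /free_fun !linear_sum; apply: eq_bigr => j _ /=.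
by rewrite !dpath_comm ph.
Qed.

Lemma contractible_injective : contractible -> nc_injective M.
Proof.
move=> [s sM] A B m mmono f.
have [h hm] := dep_choice (fun t =>
  linear_extend (f t) (fun x (e : m t x = 0) => nc_mono_inj mmono e)).
exists (nc_comp (free_map (V := M) (fun=> idfun))
         (cofree_map (V := M) (fun t => s t \o h (t + n%:Z)))) => i x.
rewrite -[in RHS](sM i (f i x)) /= /free_fun; apply: eq_bigr => j _ /=.
by rewrite /cofree_fun -!dpath_comm /= hm.
Qed.

Lemma contractible_of_exact :
    (forall t x, nc_d M (t + n%:Z) x = 0 -> exists y, dM (t + n%:Z) t y = x) ->
  contractible.
Proof.
move=> ex.
have kerP i : exists r : {linear M i -> M i},
    (forall x, nc_d M i (r x) = 0) /\ (forall x, nc_d M i x = 0 -> r x = x).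
  apply: linear_projector => [|c u v du dv]; first exact: linear0.
  by rewrite linearP du dv scaler0 addr0.
have [r rP] := dep_choice kerP.
have sigmaP t : exists h : {linear M (t + n%:Z) -> M t},
    forall y, nc_d M _ y = 0 -> dM (t + n%:Z) t (h y) = y.
  have [|h hP] := @linear_lift _ _ _ _ (dM (t + n%:Z) t) (r (t + n%:Z)).
    by move=> x; apply: ex; apply: (rP _).1.
  by exists h => y dy; rewrite hP (rP _).2.
have [sigma sigmaK] := dep_choice sigmaP.
(* Every term with j < n applies d to [x] at least once, so only d^n sigma survives. *)
have base i x : nc_d M i x = 0 -> boundary sigma i x = x.
  move=> dx; rewrite boundaryE big_ord_recr /= big1 => [|j _]; last first.
    rewrite -[dM (_ + n%:Z) i x]dpath_dr ?dx ?linear0 //.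
    by have := ltn_ord j; lia.
  have last t : i = t + n%:Z -> dM i t (sigma t (dM (t + n%:Z) i x)) = x.
    by move=> e; move: x dx; rewrite e => x dx; rewrite dpath_id sigmaK.
  by rewrite add0r last //; lia.
suff H m : exists s : homotopy,
    forall i x, dM (i + m%:Z) i x = 0 -> boundary s i x = x.
  have [s sM] := H n.+1; exists s => i x; apply: sM.
  by apply: (dpath_eq0 (A := M)).
elim: m => [|m [s sM]].
  exists (fun=> \0) => i x; have -> : i + 0%:Z = i by lia.
  by rewrite dpath_id => ->; rewrite linear0.
(* With h_s the endomorphism induced by s, replacing s by s + (1 - h_s) sigma turns
   1 - h_s into (1 - h_s) (1 - h_sigma). *)
pose u i : {linear M i -> M i} := idfun \- boundary s i.
exists (fun t => s t \+ (u t \o sigma t)) => i x dx.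
(* d^m x lies in ker d, where [boundary sigma] is the identity. *)
have zP : dM (i + m%:Z) i (x - boundary sigma i x) = 0.
  rewrite linearB -dpath_comm base ?subrr //.
  by rewrite -dpath_dl; [have -> : i + m%:Z + 1 = i + m.+1%:Z by lia | lia].
have ucomm : forall j t y, u j (dM j t y) = dM j t (u t y).
  by move=> j t y; rewrite [RHS]linearB -(dpath_comm (boundary s)).
have -> : boundary (fun t => s t \+ (u t \o sigma t)) i x =
    boundary s i x + u i (boundary sigma i x).
  rewrite !boundaryE linear_sum -big_split; apply: eq_bigr => j _ /=.
  by rewrite linearD -ucomm.
by rewrite [u i _]/(_ - boundary s i _) addrCA -linearB sM // addrC subrK.
Qed.

End Contraction.

(** * Vanishing of amplitude cohomology against exactness, projectivity and injectivity *)

Section AmplitudeCohomology.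
Variables (k : fieldType) (n : nat) (M : ncomplex k n.+1).

Local Notation dM := (dpath (nc_d M)).

Lemma AH_vanishes_exact a : (1 <= a <= n)%N -> AH_vanishes M a ->
  forall t x, nc_d M (t + n%:Z) x = 0 -> exists y, dM (t + n%:Z) t y = x.
Proof.
move=> an /AH_vanishesP => /(_ ltac:(lia)) H.
suff K m i x : (m <= n)%N -> nc_d M i x = 0 -> exists y, dM i (i - m%:Z) y = x.
  move=> t x dx; have [y] := K n _ x (leqnn n) dx.
  by move: y; rewrite addrK => y yx; exists y.
elim: m => [|m IHm] mn dx.
  by exists (dM (i - 0%:Z) i x); rewrite dpath_comp ?dpath_id //; lia.
have [y yx] := IHm (ltnW mn) dx.
have dy : dM (i + 1) (i - m%:Z) y = 0 by rewrite dpath_dl ?yx //; lia.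
(* Here d^(m+1) y = 0. If m + 1 <= a, the hypothesis applies to [y] itself and gains a factor
   d^(N-a). *)
have [ma|am] := leqP m.+1 a.
  have [|z yz] := H _ y.
    by rewrite -(@dpath_comp _ _ _ _ (i + 1)) ?dy ?linear0 //; lia.
  exists (dM (i - m.+1%:Z) _ z).
  by rewrite -yx yz !dpath_comp //; lia.
(* Otherwise it applies to d^(m+1-a) y, with [z] in degree i - n, so that x = d^n z. *)
have [|z yz] := H (i + 1 - a%:Z) (dM (i + 1 - a%:Z) (i - m%:Z) y).
  rewrite dpath_comp; [|lia|lia].
  by have -> : i + 1 - a%:Z + a%:Z = i + 1 by lia.
exists (dM (i - m.+1%:Z) _ z).
rewrite dpath_comp; [|lia|lia].
rewrite -yx -(@dpath_comp _ _ _ _ (i + 1 - a%:Z) (i - m%:Z)); [|lia|lia].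
by rewrite yz dpath_comp //; lia.
Qed.

Lemma projective_AH_vanishes a : (1 <= a <= n)%N -> nc_projective M -> AH_vanishes M a.
Proof.
move=> an projM; apply/AH_vanishesP; first by lia.
move=> i x dx; set b := (n.+1 - a)%N.
have ab : (a + b = n.+1)%N by rewrite /b; lia.
pose p := free_map (V := M) (B := M) (fun=> idfun).
have pepi : nc_epi p.
  move=> C g h gh j y; have [m pm] := free_map_top (B := M) (fun=> idfun) y.
  by rewrite -[y]pm; apply: gh.
have [g pg] := projM _ _ p pepi (nc_id M).
pose m : dprod M := g i x.
(* These are the components that d^a leaves intact, while d^a (g x) = g (d^a x) = 0. *)
have m0 t : t <= i -> i + a%:Z <= t + n%:Z -> m t = 0.
  move=> ti it; have iia : i < i + a%:Z by lia.
  have := dpath_free (g i x) t iia.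
  by rewrite ti it -dpath_comm dx linear0 => /esym.
(* Terms with j >= b factor through d^b; those with j < b vanish by [m0]. *)
exists (\sum_(j < n.+1) dM (i - b%:Z) (i - j%:Z) (m (i - j%:Z))).
rewrite -[LHS](pg i x) [LHS]free_mapE linear_sum; apply: eq_bigr => j _.
have [jb|bj] := ltnP j b; last by rewrite dpath_comp //; lia.
have mj : m (i - j%:Z) = 0 by apply: m0; lia.
by rewrite -[g i x]/m mj !linear0.
Qed.

Lemma injective_AH_vanishes a : (1 <= a <= n)%N -> nc_injective M -> AH_vanishes M a.
Proof.
move=> an injM; apply/AH_vanishesP; first by lia.
move=> i x dx; set b := (n.+1 - a)%N.
have ab : (a + b = n.+1)%N by rewrite /b; lia.
pose V t : lmodType k := M (t + n%:Z).
pose q := cofree_map (A := M) (V := V) (fun=> idfun).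
have qmono : nc_mono q.
  move=> C g h gh j y.
  have {gh} qgh : q j (g j y) = q j (h j y) := gh j y.
  (* In degree t + n, component t of [q] is the identity. *)
  have qE t : j = t + n%:Z -> g j y = h j y.
    move=> e; move: qgh; move: (g j y) (h j y); rewrite e => u v quv.
    have bottom w : (q (t + n%:Z) w : dprod V) t = w.
      exact: (cofree_map_bottom (V := V)).
    by rewrite -[u]bottom quv.
  by apply: (qE (j - n%:Z)); lia.
have [r rq] := injM _ _ q qmono (nc_id M).
(* The components of [q i x], read in degree i - b. Then d^b y = q x, as d^b erases only zero
   components: those with t + n < i, and those with t > i - b, where t + n >= i + a and d^a x =
   0. *)
pose y : freeC n V (i - b%:Z) := fun t => dM (t + n%:Z) i x.
exists (r _ y); rewrite -dpath_comm -[LHS](rq i x); congr (r i _).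
apply: functional_extensionality_dep => t; rewrite dpath_free; last by lia.
rewrite [LHS]cofree_mapE /=; case: ifP => // c.
have [it|ti] := ltP (t + n%:Z) i; first by rewrite dpath_lt.
by rewrite -(@dpath_comp _ _ _ _ (i + a%:Z)) ?dx ?linear0 //; lia.
Qed.

End AmplitudeCohomology.

Theorem theorem3p3 (k : fieldType) (N : nat) (hN : (2 <= N)%N)
    (M : ncomplex k N) (hM : forall i : int, finite_dim (M i)) :
  [/\ (exists a : nat, (1 <= a <= N - 1)%N /\ AH_vanishes M a)
        <-> nc_projective M,
      nc_projective M <-> nc_injective M
    & nc_projective M ->
        forall a : nat, (1 <= a <= N - 1)%N -> AH_vanishes M a].
Proof.
case: N hN M {hM} => // n n1 M; rewrite subn1.
have contr a : (1 <= a <= n)%N -> AH_vanishes M a -> contractible M.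
  by move=> an /(AH_vanishes_exact an); apply: contractible_of_exact.
(* Amplitude 1 exists because N >= 2; it links projectivity and injectivity through
   contractibility. *)
have n11 : (1 <= 1 <= n)%N by lia.
split; [split | split |].
- by move=> [a [an /(contr a an)]]; apply: contractible_projective.
- by move=> projM; exists 1; split; [|apply: projective_AH_vanishes].
- by move/(projective_AH_vanishes n11)/(contr 1 n11); apply: contractible_injective.
- by move/(injective_AH_vanishes n11)/(contr 1 n11); apply: contractible_projective.
- by move=> projM a an; apply: projective_AH_vanishes.
Qed.
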